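(* Let $P_\sigma(T)$ be a Veronese $d$-polytope with induced circular composition $(\mathring T,\mathring D)$ and structure map $\tau:T\to\mathring T$. Then a subset $S\subseteq T$ with $|S|=d$ corresponds to a facet of $P_\sigma(T)$ if and only if $\tau(S)$ satisfies the circular facet condition with respect to $\mathring D$.
   Context: Setting: $d\ge1$, $n\ge d+1$, $T=\{t_1<\dots<t_n\}\subset\mathbb R$, $\nu_d(t)=(1,t,\dots,t^d)$, $q_\xi(t)=\sum_{i=0}^d\xi_it^i$. A chamber $\sigma$ is the closure of a connected component of the complement in $\mathbb R^{d+1}$ of the hyperplanes $\{\xi:q_\xi(t)=0\}$, $t\in T$; $P_\sigma(T)=\mathrm{conv}\{\nu_d(t)/q_\xi(t):t\in T\}$ for any $\xi$ in the interior of $\sigma$ (a $d$-polytope whose combinatorial type depends only on $\sigma$). $S$ corresponds to a facet if $\{\nu_d(t)/q_\xi(t):t\in S\}$ is the vertex set of a facet. The signed $\sigma$-decomposition partitions $T$ into maximal runs $I_1<\dots<I_{k+1}$ of consecutive elements on which $\mathrm{sgn}\,q_\xi$ is constant ($0\le k\le d$); write $I_j=\{t_{j,1}<\dots<t_{j,n_j}\}$. Cyclic order: a set $\mathring T$ with a ternary relation $C$ such that $(a,b,c)\in C\Rightarrow(b,c,a)\in C$; $(a,b,c)\in C\Rightarrow(c,b,a)\notin C$; $(a,b,c),(a,c,d)\in C\Rightarrow(a,b,d)\in C$; and for pairwise distinct $a,b,c$ either $(a,b,c)\in C$ or $(c,b,a)\in C$. $b$ follows consecutively after $a$ if $(b,x,a)\in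 C$ for all $x\ne a,b$; $\{a,b\}$ is a consecutive pair (also called a divider) if one follows consecutively after the other. Induced circular composition: $\mathring T$ is a set of $n$ elements, $\tau:T\to\mathring T$ a bijection, and $\mathring T$ is given the cyclic order in which $\tau(t_{i+1})$ follows consecutively after $\tau(t_i)$ for $i\in[n-1]$ and $\tau(t_1)$ follows consecutively after $\tau(t_n)$. The set of dividers $\mathring D$ consists of $\{\tau(t_{j,n_j}),\tau(t_{j+1,1})\}$ for $j\in[k]$, together with the additional divider $\{\tau(t_{k+1,n_{k+1}}),\tau(t_{1,1})\}$ exactly when $d$ and $k$ have different parities. Thus $l=|\mathring D|$ satisfies $0\le l\le d$ and $l\equiv d\pmod 2$. Circular facet condition: with $\mathring D=\{\{a_1,b_1\},\dots,\{a_l,b_l\}\}$, a subset $\mathring S\subset\mathring T$ with $|\mathring S|=d$ satisfies it if $\mathring S=\mathring S_1\sqcup\mathring S_2$ where $\mathring S_1=\{\mathring S_1^1,\dots,\mathring S_1^l\}$ consists of $l$ distinct elements with $\mathring S_1^j\in\{a_j,b_j\}$ for $j\in[l]$, and $\mathring S_2$ consists of the remaining $d-l$ points, which occur as $\frac{d-l}{2}$ consecutive pairs. *)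

(* Defs.v *)
From HB Require Import structures.
From mathcomp Require Import all_boot all_order all_algebra.
From mathcomp Require Import all_classical all_reals all_analysis.
Import Order.TTheory GRing.Theory Num.Theory.
Import numFieldNormedType.Exports.

Set Implicit Arguments.
Unset Strict Implicit.
Unset Printing Implicit Defensive.

Local Open Scope classical_set_scope.
Local Open Scope ring_scope.

Section ConvexPolytopes.
Variables (R : realType) (m : nat).
Implicit Types (A F P : set 'rV[R]_m) (c x y : 'rV[R]_m).

Definition dotv c x : R := \sum_i c 0 i * x 0 i.

Definition conv_hull (I : finType) (p : I -> 'rV[R]_m) : set 'rV[R]_m :=
  [set x | exists w : I -> R,
     [/\ forall i, 0 <= w i, \sum_i w i = 1 & x = \sum_i w i *: p i]].

(* [x + V] is the affine hull of [A], i.e. the least affine subspace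
   containing it.  The empty set gets no dimension (rather than -1). *)
Definition affine_dim A (k : nat) : Prop :=
  exists x (V : {vspace 'rV[R]_m}),
    [/\ A x, forall y, A y -> y - x \in V,
        forall W : {vspace 'rV[R]_m},
          (forall y, A y -> y - x \in W) -> (V <= W)%VS
      & \dim V = k].

Definition face P F : Prop :=
  exists c (b : R),
    (forall x, P x -> dotv c x <= b) /\ F = [set x | P x /\ dotv c x = b].

Definition facet P F : Prop :=
  face P F /\ exists k, affine_dim P k.+1 /\ affine_dim F k.

Definition vertices P : set 'rV[R]_m := [set x | face P [set x]].

End ConvexPolytopes.

(* The set T = {t_1 < ... < t_n} is given by its increasing enumeration
   [t : 'I_n -> R] (indices shifted to start from 0), and a subset of T by the
   set of the indices of its elements. *)
Section Veronese.
Variables (R : realType) (d n : nat) (t : 'I_n -> R).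
Implicit Types (xi : 'rV[R]_d.+1) (sigma : set 'rV[R]_d.+1).
Implicit Types (A S : {set 'I_n}) (a b : 'I_n).

Definition veronese (s : R) : 'rV[R]_d.+1 := \row_(i < d.+1) s ^+ i.

Definition q xi (s : R) : R := \sum_(i < d.+1) xi 0 i * s ^+ i.

Definition hyperplane_complement : set 'rV[R]_d.+1 :=
  [set xi | forall i, q xi (t i) != 0].

Definition chamber sigma : Prop :=
  exists2 xi, hyperplane_complement xi
            & sigma = closure (connected_component hyperplane_complement xi).

Definition veronese_point xi (i : 'I_n) : 'rV[R]_d.+1 :=
  (q xi (t i))^-1 *: veronese (t i).

Definition veronese_polytope xi : set 'rV[R]_d.+1 :=
  conv_hull (veronese_point xi).

Definition corresponds_to_facet xi S : Prop :=
  exists2 F, facet (veronese_polytope xi) F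
           & vertices F = [set veronese_point xi i | i in [set` S]].

Definition sign_run xi : pred {set 'I_n} := fun A =>
  [&& A != finset.set0,
      [forall a in A, forall c in A, forall b : 'I_n, (a <= b <= c)%N ==> (b \in A)]
    & [forall a in A, forall b in A,
         Num.sg (q xi (t a)) == Num.sg (q xi (t b))]].

Definition signed_decomposition xi k (I : 'I_k.+1 -> {set 'I_n}) : Prop :=
  [/\ forall i, exists j, i \in I j,
      forall j, maxset (sign_run xi) (I j)
    & forall j j' : 'I_k.+1, (j < j')%N ->
        forall a b, a \in I j -> b \in I j' -> (a < b)%N].

Definition is_first A a : bool := (a \in A) && [forall b in A, (a <= b)%N].
Definition is_last A a : bool := (a \in A) && [forall b in A, (b <= a)%N].

End Veronese.

Section CyclicOrders.
Variables (X : finType) (C : X -> X -> X -> Prop).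

Definition cyclic_order : Prop :=
  [/\ forall a b c, C a b c -> C b c a,
      forall a b c, C a b c -> ~ C c b a,
      forall a b c e, C a b c -> C a c e -> C a b e
    & forall a b c, a != b -> b != c -> a != c -> C a b c \/ C c b a].

(* [b] follows consecutively after [a] *)
Definition follows (a b : X) : Prop :=
  forall x, x != a -> x != b -> C b x a.

Definition consecutive_pair (B : {set X}) : Prop :=
  exists a b, [/\ a != b, B = [set a; b]%SET & follows a b \/ follows b a].

Definition circular_facet_condition (d : nat) (D : {set {set X}})
    (S : {set X}) : Prop :=
  #|S| = d /\
  exists S1 S2 : {set X},
    [/\ S = (S1 :|: S2)%SET, (S1 :&: S2)%SET = finset.set0,
        exists f : {set X} -> X,
          [/\ {in D &, injective f}, forall B, B \in D -> f B \in B
            & S1 = (f @: D)%SET]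
      & exists P : {set {set X}},
          [/\ finset.partition P S2, #|P| = ((d - #|D|)./2)%N
            & forall B, B \in P -> consecutive_pair B]].

End CyclicOrders.

Section CircularComposition.
Variables (R : realType) (d n : nat) (t : 'I_n -> R) (X : finType).
Variable tau : 'I_n -> X.

Definition dividers k (I : 'I_k.+1 -> {set 'I_n}) : {set {set X}} :=
  [set B : {set X} | [exists a : 'I_n, exists b : 'I_n, (B == [set tau a; tau b])%SET &&
     ([exists j : 'I_k.+1, exists j' : 'I_k.+1,
         [&& j' == j.+1 :> nat, is_last (I j) a & is_first (I j') b]]
      || [&& odd d != odd k, is_last (I ord_max) a & is_first (I ord0) b])]]%SET.

Definition induced_circular_composition (sigma : set 'rV[R]_d.+1)
    (C : X -> X -> X -> Prop) (D : {set {set X}}) : Prop :=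
  [/\ bijective tau,
      cyclic_order C,
      forall i j : 'I_n, j = i.+1 :> nat -> follows C (tau i) (tau j),
      forall i j : 'I_n, i = 0%N :> nat -> j = n.-1 :> nat ->
        follows C (tau j) (tau i)
    & exists xi k (I : 'I_k.+1 -> {set 'I_n}),
        [/\ sigma° xi, signed_decomposition t xi I & D = dividers I]].

End CircularComposition.

(* Main.v *)
Require Import Defs.
From mathcomp Require Import all_boot all_order all_algebra.
From mathcomp Require Import zify.
From mathcomp Require Import all_classical all_reals all_analysis.
Import Order.TTheory GRing.Theory Num.Theory.
Import numFieldNormedType.Exports.

Set Implicit Arguments.
Unset Strict Implicit.
Unset Printing Implicit Defensive.

(* A hyperplane supporting the polytope along the points of [S] is, since
   [dotv xi] is constantly 1 on them, the zero set of a multiple of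
   [p_S = \prod_(s in S) (X - t_s)].  Hence [S] gives a facet iff
   [p_S(t_i) q_xi(t_i)] has the same sign for all [i] outside [S].  Counting the
   points of [S] and the dividers met while walking around the circle, this says
   that between any two points outside [S] the count is even; the additional
   divider is what makes the total count even, so that the condition is cyclic.
   An even count between the points outside [S] allows one to match each point
   of [S] or divider met at an even count with the next one met: a
   divider is then matched with one of its endpoints, and the remaining points
   of [S] are matched in consecutive pairs.  Conversely, such a matching makes
   every count between two points outside [S] even. *)

(** * Matchings on a cycle *)

Section CyclicSelection.
Variables (X : finType) (nxt prv : X -> X).
Hypotheses (prvK : cancel prv nxt) (nxtK : cancel nxt prv).
Hypothesis nxt_neq : forall x, nxt x != x.

Definition edge (x : X) : {set X} := [set x; nxt x]%SET.

Lemma in_edge x y : (y \in edge x) = (y == x) || (y == nxt x).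
Proof. by rewrite !inE. Qed.

Lemma card_edge x : #|edge x| = 2%N.
Proof. by rewrite cards2 eq_sym nxt_neq. Qed.

(** Only on a cycle of two points do different points have the same edge; [edge_inj] and [two_cycle]
    below deal with that case. *)
Lemma edge_eq x y : edge x = edge y -> x = y \/ y = nxt x /\ nxt y = x.
Proof.
move=> exy; have := in_edge y x; rewrite -exy in_edge eqxx /=.
case: (eqVneq x y) => [->|nxy]; first by left.
move=> /esym/eqP xE; have := in_edge x y; rewrite exy in_edge eqxx /=.
by rewrite eq_sym (negbTE nxy) /= => /esym/eqP yE; right.
Qed.

Variables (C : X -> X -> X -> Prop) (E S : {set X}) (d : nat).
Hypothesis consE : forall B, consecutive_pair C B <-> exists x, B = edge x.
Hypothesis edge_inj : {in E &, injective edge}.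
Hypothesis two_cycle : forall x, nxt (nxt x) = x -> x \in S -> nxt x \notin S.
Hypothesis cardS : #|S| = d.

(* Walking around the cycle, count points of [S] and edges of [E] mod 2; the
   points and edges met at an even count are matched with the next one met. *)
Lemma parity_circular_facet (x0 : X) (h : X -> bool) :
    (forall x, x \notin S -> h x = false) ->
    (forall x, h (nxt x) = h x (+) (x \in S) (+) (x \in E)) ->
  circular_facet_condition C d (edge @: E)%SET S.
Proof.
move=> h0 hS; split=> //.
have hSt x : h x -> x \in S by case: (boolP (x \in S)) => // /h0 ->.
(* [h x] is the count before [x]. For [x] in [E], the divider takes [x] if this point is met at an
   even count; otherwise the edge itself is met at an even count and takes [nxt x]. *)
pose g x := if (x \in S) && ~~ h x then x else nxt x.
(* The selection has to be a function of the set [edge x], so [x] is recovered from it through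
   [edge_inj]. *)
pose src (B : {set X}) := [pick x in E | B == edge x].
have srcE x : x \in E -> src (edge x) = Some x.
  move=> xE; rewrite /src; case: pickP => [y /andP[yE /eqP exy]|/(_ x)].
    by congr Some; apply: edge_inj.
  by rewrite xE eqxx.
have gS x : x \in E -> g x \in S.
  move=> xE; rewrite /g; case: ifP => [/andP[]//|hx].
  apply: (hSt _); rewrite hS xE; move: hx (hSt x).
  by case: (x \in S) (h x) => -[] //= _ /(_ isT).
have g_inj : {in E &, injective g}.
  have aux x y : x \in E -> y \in E -> x = nxt y -> x \in S -> ~~ h x ->
     ~~ ((y \in S) && ~~ h y) -> False.
    move=> xE yE -> _; rewrite hS yE; move: (hSt y).
    by case: (y \in S) (h y) => -[] // /(_ isT).
  move=> x y xE yE; rewrite /g.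
  case: ifP => [/andP[xS hx]|/negbT nx]; case: ifP => [/andP[yS hy]|/negbT ny] //.
  - by move=> e; case: (aux x y).
  - by move=> e; case: (aux y x).
  - by move=> /(can_inj nxtK).
pose S1 := (g @: E)%SET.
(* First points of the consecutive pairs: met at an even count, with no divider after them, so the
   count at [nxt x] is odd and [nxt x] lies in [S]. *)
pose H := [set x in S | ~~ h x & x \notin E]%SET.
have HS x : x \in H -> nxt x \in S.
  by rewrite !inE => /and3P[xS hx xE]; apply: (hSt _); rewrite hS xS (negbTE hx) (negbTE xE).
have Hh x : x \in H -> h (nxt x).
  by rewrite !inE => /and3P[xS hx xE]; rewrite hS xS (negbTE hx) (negbTE xE).
have S1S : (S1 \subset S)%SET by apply/fintype.subsetP => _ /imsetP[x xE ->]; exact: gS.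
have cover_P : finset.cover (edge @: H)%SET = (S :\: S1)%SET.
  apply/setP => y; apply/bigcupP/idP.
    move=> [_ /imsetP[x xH ->]]; rewrite in_edge !inE => /orP[] /eqP ->.
      have := xH; rewrite !inE => /and3P[-> hx xE]; rewrite andbT.
      apply/imsetP => -[z zE]; rewrite /g; case: ifP.
        by move=> _ e; rewrite e zE in xE.
      move=> zS e; move: hx zS; rewrite e hS zE.
      by move: (hSt z); case: (z \in S) (h z) => -[] // /(_ isT).
    rewrite HS // andbT; apply/imsetP => -[z zE]; rewrite /g; case: ifP.
      by move=> /andP[_ hz] e; move: (Hh _ xH); rewrite e (negbTE hz).
    move=> _ /(can_inj nxtK) e; move: xH; rewrite e inE zE.
    by rewrite !andbF.
  rewrite !inE => /andP[yS1 yS].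
  (* Among the points not selected by a divider, one met at an even count opens a pair and one met
     at an odd count closes the pair opened by its predecessor. *)
  case hy: (h y); last first.
    exists (edge y); last by rewrite in_edge eqxx.
    apply/imset_f; rewrite !inE yS hy /=; apply: contra yS1 => yE.
    by apply/imsetP; exists y => //; rewrite /g yS hy.
  have yE := prvK y; set z := prv y in yE.
  exists (edge z); last by rewrite in_edge yE eqxx orbT.
  apply/imset_f; rewrite inE.
  have := hS z; rewrite yE hy; case zE: (z \in E).
    move=> e; case/negP: yS1; apply/imsetP; exists z => //.
    rewrite /g yE; case: ifP => // /andP[zS hz].
    by move: e; rewrite zS (negbTE hz).
  move: (hSt z); case: (z \in S) (h z) => -[] // /(_ isT) //.
have triv_P : forall A B, A \in (edge @: H)%SET -> B \in (edge @: H)%SET ->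
    A != B -> [disjoint A & B].
  move=> _ _ /imsetP[x xH ->] /imsetP[y yH ->] nxy.
  apply/pred0P => z /=; apply/negP => /andP[].
  have nhx : h x = false by move: xH; rewrite !inE => /and3P[_ /negbTE].
  have nhy : h y = false by move: yH; rewrite !inE => /and3P[_ /negbTE].
  rewrite !in_edge => /orP[] /eqP -> /orP[] /eqP e.
  - by rewrite e eqxx in nxy.
  - by move: (Hh _ yH); rewrite -e nhx.
  - by move: (Hh _ xH); rewrite e nhy.
  - by move/(can_inj nxtK): e => e; rewrite e eqxx in nxy.
have part_P : finset.partition (edge @: H)%SET (S :\: S1)%SET.
  apply/and3P; split; first by rewrite cover_P.
    by apply/finset.trivIsetP.
  apply/imsetP => -[x _ e]; have := in_edge x x.
  by rewrite -e inE eqxx.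
have S1U : S = (S1 :|: S :\: S1)%SET.
  by apply/setP => x; rewrite !inE; case: (boolP (x \in S1)) => //= /(fintype.subsetP S1S).
have cardE : #|(edge @: E)%SET| = #|S1| by rewrite !card_in_imset.
exists S1, (S :\: S1)%SET; split => //.
- by apply/setP => x; rewrite !inE; case: (x \in S1).
(* [x0] is a default value for sets that are not dividers. *)
- exists (fun B => if src B is Some x then g x else x0); split.
  + move=> _ _ /imsetP[x xE ->] /imsetP[y yE ->]; rewrite !srcE //.
    by move=> /(g_inj _ _ xE yE) ->.
  + move=> _ /imsetP[x xE ->]; rewrite srcE // in_edge /g.
    by case: ifP; rewrite eqxx ?orbT.
  + apply/setP => y; apply/imsetP/imsetP => -[x xE ->].
      by exists (edge x); [exact: imset_f | rewrite srcE].
    by case/imsetP: xE => z zE ->; exists z => //; rewrite srcE.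
exists (edge @: H)%SET; split=> //; last first.
  by move=> _ /imsetP[x _ ->]; apply/consE; exists x.
have := card_uniform_partition (n := 2%N) _ part_P.
rewrite cardsDS // cardS cardE => -> //; first by rewrite muln2 doubleK.
by move=> _ /imsetP[x _ ->]; exact: card_edge.
Qed.

(** Take for [h x] whether the edge entering [x] uses [x], as selected endpoint or as member of a
    pair. A divider uses exactly one endpoint, any other edge both or none; a point of [S] is used
    by exactly one of its two edges, a point outside [S] by none. *)
Lemma circular_facet_parity :
  circular_facet_condition C d (edge @: E)%SET S ->
  exists h : X -> bool, (forall x, x \notin S -> h x = false) /\
    forall x, h (nxt x) = h x (+) (x \in S) (+) (x \in E).
Proof.
move=> [_ [S1 [S2 [SU SI [f [f_inj fB S1E]] [P [Ppart _ PC]]]]]].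
pose used x y := ((x \in E) && (f (edge x) == y)) || (edge x \in P).
have fS1 x : x \in E -> f (edge x) \in S1.
  by move=> xE; rewrite S1E; apply/imset_f/imset_f.
have S1S x : x \in S1 -> x \in S by move=> xS; rewrite SU inE xS.
have PS2 x : edge x \in P -> (x \in S2) /\ (nxt x \in S2).
  move=> xP; case/and3P: Ppart => /eqP <- _ _.
  by split; apply/bigcupP; exists (edge x); rewrite // in_edge eqxx ?orbT.
have S2S x : x \in S2 -> x \in S by move=> xS; rewrite SU inE xS orbT.
have S12 x : x \in S1 -> x \in S2 = false.
  by move=> xS; have := finset.in_setI x S1 S2; rewrite SI xS inE.
have fE x : x \in E -> (f (edge x) == nxt x) = ~~ (f (edge x) == x).
  move=> xE; have := fB _ (imset_f edge xE); rewrite in_edge.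
  by case/orP => /eqP ->; rewrite eqxx ?[x == _]eq_sym (negbTE (nxt_neq x)).
have EP x : x \in E -> edge x \in P = false.
  move=> xE; apply/negP => /PS2[xS nS].
  have := fB _ (imset_f edge xE); rewrite in_edge => /orP[] /eqP e;
  by move: (S12 _ (fS1 _ xE)); rewrite e ?xS ?nS.
exists (fun x => used (prv x) x); split=> [x xS|x].
  apply/negbTE; apply: contra xS => /orP[/andP[xE /eqP <-]|/PS2[_]].
    exact/S1S/fS1.
  by rewrite prvK => /S2S.
rewrite nxtK; have -> : used x (nxt x) = used x x (+) (x \in E).
  rewrite /used; case: (boolP (x \in E)) => [xE|_] /=; last by rewrite addbF.
  by rewrite fE // EP // !orbF addbT.
congr (_ (+) _); suff : used (prv x) x (+) used x x = (x \in S).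
  by move=> <-; rewrite addbA addbb.
have y'E := prvK x; set y := prv x in y'E *.
case: (boolP (x \in S1)) => [xS1|xS1].
  have nP z : x \in edge z -> edge z \in P = false.
    rewrite in_edge => xz; apply/negP => /PS2[zS nS].
    by case/orP: xz => /eqP e; move: (S12 _ xS1); rewrite e ?zS ?nS.
  rewrite (S1S _ xS1) /used !nP ?in_edge ?eqxx ?y'E ?eqxx ?orbT // !orbF.
  have both : y \in E -> x \in E -> f (edge y) = x -> f (edge x) <> x.
    move=> yE xE fy fx; have := f_inj _ _ (imset_f _ yE) (imset_f _ xE).
    rewrite fy fx => /(_ erefl) /(edge_inj yE xE) e.
    by have := nxt_neq y; rewrite y'E e eqxx.
  move: xS1; rewrite S1E => /imsetP[_ /imsetP[z zE ->] xf].
  have := fB _ (imset_f edge zE); rewrite -xf in_edge => /orP[] /eqP e.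
    move: zE xf; rewrite -e => zE xf; rewrite zE -xf eqxx /=.
    case yE : (y \in E) => //=; case: eqP => // fy.
    by case: (both yE zE).
  have zy : z = y by apply: (can_inj nxtK); rewrite -e y'E.
  rewrite -zy in both *; rewrite zE -xf eqxx /=.
  by case xE : (x \in E) => //=; case: eqP => // /(both zE xE (esym xf)).
have fx z : z \in E -> (f (edge z) == x) = false.
  by move=> zE; apply: contraNF xS1 => /eqP <-; exact: fS1.
have uE z : used z x = (edge z \in P).
  by rewrite /used; case zE: (z \in E); rewrite //= fx.
rewrite !uE SU inE (negbTE xS1) /=.
have xP z : x \in edge z -> edge z \in P -> x \in S2.
  by rewrite in_edge => xz /PS2[zS nS]; case/orP: xz => /eqP ->.
have xy : x \in edge y by rewrite in_edge y'E eqxx orbT.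
have xx : x \in edge x by rewrite in_edge eqxx.
apply/idP/idP.
  case: (boolP (edge y \in P)) => [/(xP _ xy)//|_] /=; exact: xP.
move=> xS2; have [B BP xB] : exists2 B, B \in P & x \in B.
  by case/and3P: Ppart => /eqP e _ _; move: xS2; rewrite -e => /bigcupP[B]; exists B.
have [z e] := (consE B).1 (PC _ BP).
(* Different pairs are disjoint; if the two edges at [x] are the same set, the cycle has two points,
   and [two_cycle] forbids both to be in [S]. *)
have yx : edge y \in P -> edge x \in P -> False.
  move=> yP xP'; case/and3P: Ppart => _ /finset.trivIsetP/(_ _ _ yP xP') tr _.
  case: (eqVneq (edge y) (edge x)) => [e'|/tr /pred0P/(_ x)]; last by rewrite /= xx xy.
  case/edge_eq: e' => [e'|[_ xny]].
    by have := nxt_neq y; rewrite y'E e' eqxx.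
  have [yS xS] := PS2 _ yP; have := @two_cycle y.
  by rewrite y'E xny => /(_ erefl (S2S _ yS)); rewrite (S2S _ xS2).
move: xB; rewrite e in_edge => /orP[] /eqP xz; last first.
  have zy : z = y by apply: (can_inj nxtK); rewrite -xz y'E.
  move: BP; rewrite e zy => yP; rewrite yP /=; apply/negP; exact: yx.
move: BP; rewrite e -xz => BP; rewrite BP addbT; apply/negP => yP; exact: yx.
Qed.

End CyclicSelection.

Local Open Scope classical_set_scope.
Local Open Scope ring_scope.

(** * Facets and supporting polynomials *)

Lemma divr_gt0E (R : realFieldType) (a b : R) : (0 < a / b) = (0 < a * b).
Proof.
have [->|b0] := eqVneq b 0; first by rewrite invr0.
have -> : a * b = a / b * b ^+ 2 by rewrite expr2 mulrA divfK.
by rewrite [RHS]pmulr_lgt0 ?exprn_even_gt0.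
Qed.

Lemma dotv_mulmx (R : realType) m (c x : 'rV[R]_m) : dotv c x = (x *m c^T) 0 0.
Proof. by rewrite mxE; apply: eq_bigr => i _; rewrite mxE mulrC. Qed.

Lemma dotv_sum (R : realType) m (I : finType) (P : pred I) (c : 'rV[R]_m)
    (w : I -> R) (p : I -> 'rV[R]_m) :
  dotv c (\sum_(i | P i) w i *: p i) = \sum_(i | P i) w i * dotv c (p i).
Proof.
rewrite dotv_mulmx mulmx_suml summxE; apply: eq_bigr => i _.
by rewrite -scalemxAl mxE -dotv_mulmx.
Qed.

Lemma dotvDl (R : realType) m (c c' x : 'rV[R]_m) (a : R) :
  dotv (a *: c + c') x = a * dotv c x + dotv c' x.
Proof.
rewrite /dotv mulr_sumr -big_split; apply: eq_bigr => i _.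
by rewrite !mxE mulrDl mulrA.
Qed.

Lemma dotvBr (R : realType) m (c x y : 'rV[R]_m) :
  dotv c (x - y) = dotv c x - dotv c y.
Proof. by rewrite /dotv -sumrB; apply: eq_bigr => i _; rewrite !mxE mulrBr. Qed.

Lemma affine_dim_unique (R : realType) m (A : set 'rV[R]_m) k k' :
  affine_dim A k -> affine_dim A k' -> k = k'.
Proof.
move=> [x [V [Ax AV minV <-]]] [x' [V' [Ax' AV' minV' <-]]].
have VV' : (V <= V')%VS.
  apply: minV => y Ay; have -> : y - x = (y - x') - (x - x') by rewrite opprB addrA subrK.
  by rewrite rpredB // AV'.
have V'V : (V' <= V)%VS.
  apply: minV' => y Ay; have -> : y - x' = (y - x) - (x' - x) by rewrite opprB addrA subrK.
  by rewrite rpredB // AV.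
by congr (\dim _); apply/eqP; rewrite eqEsubv VV'.
Qed.

Lemma span_dotv0 (R : realType) m (c : 'rV[R]_m) (X : seq 'rV[R]_m) y :
  y \in <<X>>%VS -> (forall x, x \in X -> dotv c x = 0) -> dotv c y = 0.
Proof.
move=> yX X0; suff /subvP/(_ _ yX) : (<<X>> <= lker (linfun (mulmxr c^T)))%VS.
  by rewrite memv_ker lfunE /= dotv_mulmx => /eqP ->; rewrite mxE.
apply/span_subvP => x /X0 x0; rewrite memv_ker lfunE /=; apply/eqP/matrixP => a b.
by rewrite !ord1 -dotv_mulmx x0 mxE.
Qed.

(* The functional [c] keeps the affine hull of the points away from the origin,
   so that its dimension is one less than that of their linear span. *)
Lemma affine_dim_span (R : realType) m (I : finType) (p : I -> 'rV[R]_m)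
    (S : {set I}) (c : 'rV[R]_m) (A : set 'rV[R]_m) i0 k :
    i0 \in S -> (forall i, i \in S -> dotv c (p i) = 1) ->
    (forall i, i \in S -> A (p i)) ->
    (forall y, A y -> exists w : I -> R,
       \sum_(i in S) w i = 1 /\ y = \sum_(i in S) w i *: p i) ->
    \dim <<[seq p i | i in S]>> = k.+1 ->
  affine_dim A k.
Proof.
move=> i0S cp Ap Aw dimS.
pose V : {vspace 'rV[R]_m} := <<[seq p i - p i0 | i in S]>>%VS.
have VP i : i \in S -> p i - p i0 \in V.
  by move=> iS; apply: memv_span; apply/fintype.imageP; exists i.
exists (p i0), V; split.
- exact: Ap.
- move=> y /Aw[w [w1 ->]].
  rewrite -[p i0]scale1r -w1 scaler_suml -sumrB; apply: memv_suml => i iS.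
  by rewrite -scalerBr memvZ // VP.
- move=> W AW; apply/span_subvP => _ /fintype.imageP[i iS ->]; exact/AW/Ap.
have spanE : <<[seq p i | i in S]>>%VS = (<[p i0]> + V)%VS.
  apply/eqP; rewrite eqEsubv; apply/andP; split.
    apply/span_subvP => _ /fintype.imageP[i iS ->].
    by rewrite -(subrK (p i0) (p i)) addrC memv_add ?memv_line ?VP.
  rewrite subv_add; apply/andP; split.
    by rewrite -memvE; apply: memv_span; apply/fintype.imageP; exists i0.
  apply/span_subvP => _ /fintype.imageP[i iS ->].
  by rewrite rpredB //; apply: memv_span; apply/fintype.imageP; [exists i|exists i0].
have disj : (<[p i0]> :&: V = 0)%VS.
  apply/eqP; rewrite -subv0; apply/subvP => y; rewrite memv_cap.
  case/andP => /vlineP[a ->] /(span_dotv0 (c := c)) ap.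
  have : dotv c (a *: p i0) = 0.
    apply: ap => _ /fintype.imageP[i iS ->].
    by rewrite dotvBr !cp // subrr.
  rewrite dotv_mulmx -scalemxAl mxE -dotv_mulmx cp // mulr1 => ->.
  by rewrite scale0r mem0v.
have pi0 : p i0 != 0.
  apply/eqP => e; have := cp _ i0S; rewrite e dotv_mulmx mul0mx mxE.
  by move/eqP; rewrite eq_sym oner_eq0.
by move: dimS; rewrite spanE dimv_disjoint_sum // dim_vline pi0 add1n => -[].
Qed.

(** * Linear independence of points on the Veronese curve *)

Section VeroneseFacets.
Variables (R : realType) (d n : nat) (t : 'I_n -> R).
Hypothesis t_inj : injective t.
Implicit Types (p : {poly R}) (S : {set 'I_n}).

Definition coef_row p : 'rV[R]_d.+1 := \row_i p`_i.

Lemma q_coef_row p s : (size p <= d.+1)%N -> q (coef_row p) s = p.[s].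
Proof.
move=> sz; rewrite (horner_coef_wide _ sz).
by apply: eq_bigr => i _; rewrite mxE.
Qed.

Definition root_poly S : {poly R} := \prod_(i in S) ('X - (t i)%:P).

Lemma size_root_poly S : size (root_poly S) = #|S|.+1.
Proof.
rewrite /root_poly -big_enum -(big_map t predT (fun a => 'X - a%:P)) size_prod_XsubC.
by rewrite size_map cardE.
Qed.

Lemma horner_root_poly S s : (root_poly S).[s] = \prod_(i in S) (s - t i).
Proof. by rewrite horner_prod; apply: eq_bigr => i _; rewrite hornerXsubC. Qed.

Lemma root_poly_neq0 S i : i \notin S -> (root_poly S).[t i] != 0.
Proof.
move=> iS; rewrite horner_root_poly; apply/prodf_neq0 => j jS.
by rewrite subr_eq0 (inj_eq t_inj); apply: contraNneq iS => ->.
Qed.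

Lemma root_poly_eq0 S i : i \in S -> (root_poly S).[t i] = 0.
Proof.
by move=> iS; rewrite horner_root_poly (bigD1 i) //= subrr mul0r.
Qed.

Lemma root_poly_unique p S : (size p <= #|S|.+1)%N ->
  (forall i, i \in S -> p.[t i] = 0) -> exists a, p = a *: root_poly S.
Proof.
move=> sz pS; have [->|p0] := eqVneq p 0; first by exists 0; rewrite scale0r.
have ur : uniq [seq t i | i in S] by rewrite map_inj_uniq ?enum_uniq.
have ar : all (root p) [seq t i | i in S].
  by apply/allP => _ /fintype.imageP[i iS ->]; apply/rootP/pS.
have szS : size [seq t i | i in S] = #|S| by rewrite size_map -cardE.
have sp : size p = (size [seq t i | i in S]).+1.
  apply/eqP; rewrite eqn_leq szS sz /=.
  by have := max_poly_roots p0 ar ur; rewrite szS.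
exists (lead_coef p); rewrite {1}(all_roots_prod_XsubC sp ar) ?uniq_rootsE //.
by rewrite /root_poly -big_enum big_map.
Qed.

Variable xi : 'rV[R]_d.+1.
Hypothesis xi_neq0 : forall i, q xi (t i) != 0.
Let v := veronese_point t xi.

Lemma dotv_veronese_point c i : dotv c (v i) = q c (t i) / q xi (t i).
Proof.
by rewrite /dotv /q mulr_suml; apply: eq_bigr => j _; rewrite !mxE mulrCA mulrC.
Qed.

Lemma dotv_xi i : dotv xi (v i) = 1.
Proof. by rewrite dotv_veronese_point divff. Qed.

(** Lagrange interpolation: the product over [S] without [i] has degree at most [d], so its
    coefficients give a functional, scaled to be 1 at [v i]. *)
Lemma dual_functional S i : (#|S| <= d.+1)%N -> i \in S ->
  exists c, forall j, j \in S -> dotv c (v j) = (j == i)%:R.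
Proof.
move=> cS iS; pose p := root_poly (S :\ i)%SET.
have sz : (size p <= d.+1)%N.
  by rewrite size_root_poly; move: cS; rewrite (cardsD1 i) iS.
exists ((q xi (t i) / p.[t i]) *: coef_row p) => j jS.
rewrite -[_ *: _]addr0 dotvDl dotv_veronese_point q_coef_row //.
rewrite dotv_mulmx linear0 mulmx0 mxE addr0.
have [->|nij] := eqVneq j i; last first.
  by rewrite [p.[t j]]root_poly_eq0 ?inE ?nij // mul0r mulr0.
have pi0 : p.[t i] != 0 by rewrite root_poly_neq0 // !inE eqxx.
by rewrite mulrA divfK // divff.
Qed.

Lemma dim_span_veronese S : (#|S| <= d.+1)%N -> \dim <<[seq v i | i in S]>> = #|S|.
Proof.
move=> cS; rewrite [RHS]cardE -(size_map v); apply/eqP.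
suff fs s : uniq s -> {subset s <= S} -> free (map v s).
  by apply: fs; [exact: enum_uniq | move=> i; rewrite mem_enum].
elim: s => [_ _|i s IHs /= /andP[ni us] sS]; first exact: nil_free.
rewrite free_cons IHs //; last by move=> j js; rewrite sS // inE js orbT.
rewrite andbT; apply/negP => vs.
have [c ci] := dual_functional cS (sS i (mem_head _ _)).
suff : dotv c (v i) = 0.
  by rewrite ci ?eqxx ?sS ?mem_head // => /eqP; rewrite oner_eq0.
apply: (span_dotv0 vs) => _ /mapP[j js ->].
rewrite ci; last by rewrite sS // inE js orbT.
by have [e|//] := eqVneq j i; rewrite -e js in ni.
Qed.

Lemma veronese_polytope_point i : veronese_polytope t xi (v i).
Proof.
exists (fun j => (j == i)%:R); split.
- by move=> j; rewrite ler0n.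
- by rewrite (bigD1 i) //= eqxx big1 ?addr0 // => j /negbTE ->.
- rewrite (bigD1 i) //= eqxx scale1r big1 ?addr0 // => j /negbTE ->.
  by rewrite scale0r.
Qed.

(** The points lie on the hyperplane where [dotv xi] is 1, and those of [S] together with [v i]
    already span the whole space linearly. *)
Lemma affine_dim_veronese_polytope S i :
  #|S| = d -> i \notin S -> affine_dim (veronese_polytope t xi) d.
Proof.
move=> cS iS; apply: (affine_dim_span (p := v) (S := [set: 'I_n]%SET) (c := xi) (i0 := i)).
- by rewrite inE.
- by move=> j _; exact: dotv_xi.
- by move=> j _; exact: veronese_polytope_point.
- by move=> y [w [_ w1 ->]]; exists w; split; [rewrite -{}w1|]; apply: eq_bigl => j; rewrite inE.
apply/eqP; rewrite eqn_leq; apply/andP; split.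
  by rewrite (leq_trans (dimvS (subvf _))) // dimvf /dim /= mul1n.
have cSi : #|(i |: S)%SET| = d.+1 by rewrite cardsU1 iS cS.
apply: (@leq_trans (\dim <<[seq v j | j in (i |: S)%SET]>>)).
  by rewrite dim_span_veronese cSi.
apply/dimvS/sub_span => _ /fintype.imageP[j _ ->].
by apply/fintype.imageP; exists j; rewrite ?inE.
Qed.

(** * The simplex cut out by a supporting functional *)

Section SupportingFacet.
Variables (S : {set 'I_n}) (c : 'rV[R]_d.+1).
Hypothesis cardS : #|S| = d.
Hypothesis c0 : forall i, i \in S -> dotv c (v i) = 0.
Hypothesis c_lt0 : forall i, i \notin S -> dotv c (v i) < 0.
Let F : set 'rV[R]_d.+1 := [set x | veronese_polytope t xi x /\ dotv c x = 0].

Let c_le0 i : dotv c (v i) <= 0.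
Proof. by case: (boolP (i \in S)) => [/c0 ->|/c_lt0/ltW]. Qed.

Lemma supporting_face : face (veronese_polytope t xi) F.
Proof.
exists c, 0; split=> // _ [w [w0 _ ->]].
by rewrite dotv_sum sumr_le0 // => i _; rewrite mulr_ge0_le0.
Qed.

(** The terms [w i * dotv c (v i)] are nonpositive with sum zero, hence all zero; strict negativity
    outside [S] then kills the weights there. *)
Lemma supporting_face_hull y : F y -> exists w : 'I_n -> R,
  [/\ forall i, 0 <= w i, \sum_(i in S) w i = 1 & y = \sum_(i in S) w i *: v i].
Proof.
move=> [[w [w0 w1 ->]]]; rewrite dotv_sum => /eqP wc0.
have wS i : i \notin S -> w i = 0.
  move=> iS; have := wc0; rewrite -oppr_eq0 -sumrN psumr_eq0; last first.
    by move=> j _; rewrite oppr_ge0 mulr_ge0_le0.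
  move=> /allP/(_ i); rewrite mem_index_enum oppr_eq0 mulf_eq0 => /(_ isT).
  by rewrite (lt_eqF (c_lt0 iS)) orbF => /eqP.
exists w; split=> //.
  rewrite -w1 [RHS](bigID (mem S)) /= [X in _ + X]big1 ?addr0 //.
rewrite (bigID (mem S)) /= [X in _ + X]big1 ?addr0 // => i /wS ->.
by rewrite scale0r.
Qed.

Lemma supporting_face_point i : i \in S -> F (v i).
Proof. by move=> iS; split; [exact: veronese_polytope_point|exact: c0]. Qed.

Lemma affine_dim_supporting_face k : d = k.+1 -> affine_dim F k.
Proof.
move=> dk; have /card_gt0P[i iS] : (0 < #|S|)%N by rewrite cardS dk.
apply: (affine_dim_span (p := v) (c := xi) iS).
- by move=> j _; exact: dotv_xi.
- exact: supporting_face_point.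
- by move=> y /supporting_face_hull[w [_ w1 yE]]; exists w.
- by rewrite dim_span_veronese cardS.
Qed.

Lemma vertices_supporting_face : vertices F = [set v i | i in [set` S]].
Proof.
apply/seteqP; split=> [x [a [b [Fab xE]]]|_ [i /= iS <-]].
  have [Fx xb] : F x /\ dotv a x = b by rewrite -/([set x | F x /\ dotv a x = b] x) -xE.
  have [w [w0 w1 xw]] := supporting_face_hull Fx.
  (* A functional exposing [x] attains its bound [b] at every [v i] of nonzero weight in [x], so
     such a [v i] lies in the exposed set, which is [x] alone. *)
  have : \sum_(i in S) w i * (b - dotv a (v i)) = 0.
    transitivity (\sum_(i in S) (w i * b - w i * dotv a (v i))).
      by apply: eq_bigr => i _; rewrite mulrBr.
    by rewrite sumrB -mulr_suml w1 mul1r -dotv_sum -xw xb subrr.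
  move/eqP; rewrite psumr_eq0; last first.
    by move=> i iS; rewrite mulr_ge0 // subr_ge0; apply/Fab/supporting_face_point.
  move=> /allP wa; have [i iS wi] : exists2 i, i \in S & w i != 0.
    apply/exists_inP; rewrite -negb_forall_in; apply/negP => /forall_inP w00.
    by move: w1; rewrite big1 => [/eqP|i /w00/eqP //]; rewrite eq_sym oner_eq0.
  exists i => //; have := wa i; rewrite mem_index_enum iS => /(_ isT).
  rewrite mulf_eq0 (negbTE wi) subr_eq0 => /eqP bE.
  have : [set x | F x /\ dotv a x = b] (v i).
    by split; [exact: supporting_face_point|].
  by rewrite -xE.
(* The functional dual to [v i] reads off the weight of [v i], which is at most 1 on [F], with
   equality at [v i] only. *)
have [a av] := @dual_functional S i (leqW (eq_leq cardS)) iS.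
have wF w : dotv a (\sum_(j in S) w j *: v j) = w i.
  rewrite dotv_sum (bigD1 i) //= av // eqxx mulr1 big1 ?addr0 //.
  by move=> j /andP[jS /negbTE ji]; rewrite av // ji mulr0.
exists a, 1; split=> [x /supporting_face_hull[w [w0 w1 ->]]|].
  rewrite wF -w1 (bigD1 i) //= lerDl sumr_ge0 //.
apply/seteqP; split=> [_ ->|x [/supporting_face_hull[w [w0 w1 ->]]]].
  by split; [exact: supporting_face_point|rewrite av ?eqxx].
rewrite wF => wi; move: w1; rewrite (bigD1 i) //= wi => /eqP.
rewrite -subr_eq0 addrAC subrr add0r psumr_eq0 // => /allP wj.
rewrite /= (bigD1 i) //= wi scale1r big1 ?addr0 // => j jS.
have := wj j; rewrite mem_index_enum jS => /(_ isT) /eqP ->.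
by rewrite scale0r.
Qed.

End SupportingFacet.

Lemma corresponds_to_facetP S : (0 < d < n)%N -> #|S| = d ->
  corresponds_to_facet t xi S <->
  exists e : R, forall i, i \notin S -> 0 < e * (root_poly S).[t i] * q xi (t i).
Proof.
move=> /andP[d0 dn] cS.
have szS : (size (root_poly S) <= d.+1)%N by rewrite size_root_poly cS.
have [i0 i0S] : exists i, i \notin S.
  apply/existsP; rewrite -negb_forall; apply/negP => /forallP allS.
  have : (#|[set: 'I_n]%SET| <= #|S|)%N by apply/subset_leq_card/fintype.subsetP.
  by rewrite cardsT card_ord cS leqNgt dn.
split=> [[F [[a [b [Pab FE]]] [k [dimP dimF]]] vF]|[e He]].
  (* Since [dotv xi] is 1 on the points, subtracting [b *: xi] makes the bound 0, and [c] becomes a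
     polynomial vanishing on [S]. *)
  pose c := - b *: xi + a.
  have cE i : dotv c (v i) = dotv a (v i) - b.
    by rewrite dotvDl dotv_xi mulr1 addrC.
  have c_le0 i : dotv c (v i) <= 0.
    by rewrite cE subr_le0; apply/Pab/veronese_polytope_point.
  pose p := \poly_(i < d.+1) c 0 (inord i).
  have szp : (size p <= d.+1)%N := size_poly _ _.
  have pE : coef_row p = c.
    by apply/rowP => i; rewrite mxE coef_poly ltn_ord inord_val.
  have cp i : dotv c (v i) = p.[t i] / q xi (t i).
    by rewrite dotv_veronese_point -pE q_coef_row.
  have pS i : i \in S -> p.[t i] = 0.
    move=> iS; have [_ [_ [_ /seteqP[/(_ _ erefl)[+ _] _]]]] : vertices F (v i).
      by rewrite vF; exists i.
    rewrite FE => -[_ ab]; have := cE i; rewrite ab subrr cp => /eqP.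
    by rewrite mulf_eq0 invr_eq0 (negbTE (xi_neq0 i)) orbF => /eqP.
  have [e pe] : exists e, p = e *: root_poly S.
    by apply: root_poly_unique pS; rewrite cS.
  (* The values of [c] are nonpositive, hence the minus sign. They are nonzero outside [S] unless
     [e] is 0, and then [F] would be the whole polytope, against its dimension. *)
  exists (- e) => i iS; rewrite -divr_gt0E.
  rewrite mulNr mulNr -hornerZ -pe -cp oppr_gt0 lt_neqAle c_le0 andbT.
  rewrite cp pe hornerZ !mulf_neq0 ?invr_neq0 ?root_poly_neq0 //.
  apply/eqP => e0; have FP : F = veronese_polytope t xi.
    rewrite FE; apply/seteqP; split=> [x []//|_ [w [w0 w1 ->]]].
    split; first by exists w.
    have av j : dotv a (v j) = b.
      by apply/eqP; rewrite -subr_eq0 -cE cp pe e0 scale0r horner0 mul0r.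
    by rewrite dotv_sum; under eq_bigr do rewrite av; rewrite -mulr_suml w1 mul1r.
  have := affine_dim_unique dimP; rewrite -FP => /(_ _ dimF) /eqP.
  by rewrite -[k.+1]add1n -[X in _ == X]add0n eqn_add2r.
pose c := coef_row (- e *: root_poly S).
have cE i : dotv c (v i) = - (e * (root_poly S).[t i] / q xi (t i)).
  rewrite dotv_veronese_point q_coef_row; last exact: leq_trans (size_scale_leq _ _) _.
  by rewrite hornerZ !mulNr.
have c0 i : i \in S -> dotv c (v i) = 0.
  by move=> iS; rewrite cE root_poly_eq0 // mulr0 mul0r oppr0.
have c_lt0 i : i \notin S -> dotv c (v i) < 0.
  by move=> /He; rewrite cE oppr_lt0 divr_gt0E.
exists [set x | veronese_polytope t xi x /\ dotv c x = 0].
  split; first exact: (supporting_face c0 c_lt0).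
  exists d.-1; rewrite prednK //; split.
    exact: (affine_dim_veronese_polytope cS i0S).
  by apply: (affine_dim_supporting_face cS c0 c_lt0); rewrite prednK.
exact: (vertices_supporting_face cS c0 c_lt0).
Qed.

End VeroneseFacets.

(** * Signs on a chamber *)

Lemma q_continuous (R : realType) d (s : R) : continuous (fun xi : 'rV[R]_d.+1 => q xi s).
Proof.
rewrite /q; elim: (index_enum _) => [|i r IHr].
  rewrite (_ : (fun _ => _) = cst 0); last by apply/funext => x; rewrite big_nil.
  exact: cst_continuous.
rewrite (_ : (fun _ => _) = (fun x : 'rV[R]_d.+1 =>
    x 0 i * s ^+ i + \sum_(j <- r) x 0 j * s ^+ j)).
  by move=> x; apply: cvgD (IHr x); apply: cvgMl; exact: coord_continuous.
by apply/funext => x; rewrite big_cons.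
Qed.

(** The values of [q] at [s] over [A] form an interval that avoids 0. *)
Lemma q_gt0_connected (R : realType) d (s : R) (A : set 'rV[R]_d.+1) x y :
  connected A -> (forall z, A z -> q z s != 0) -> A x -> A y -> 0 < q x s * q y s.
Proof.
move=> cA A0 Ax Ay.
have : connected [set q z s | z in A].
  apply: connected_continuous_connected => //.
  exact/continuous_subspaceT/q_continuous.
move/connected_intervalP => itv; rewrite ltNge; apply/negP => xy0.
have no0 : ~ [set q z s | z in A] 0 by move=> [z /A0/eqP].
apply: no0; move: xy0 (A0 _ Ax) (A0 _ Ay).
have [x0|x0|->//] := ltgtP (q x s) 0; have [y0|y0|->//] := ltgtP (q y s) 0.
- by rewrite nmulr_rle0 // leNgt y0.
- by move=> _ _ _; apply: (itv (q x s) (q y s)); [exists x|exists y|rewrite !ltW].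
- by move=> _ _ _; apply: (itv (q y s) (q x s)); [exists y|exists x|rewrite !ltW].
- by rewrite pmulr_rle0 // leNgt y0.
Qed.

(** Passing to the closure leaves only weak inequalities; they are strict at an interior point,
    which can be moved slightly so as to decrease [e i * q xi (t i)]. *)
Lemma chamber_sign (R : realType) d n (t : 'I_n -> R) (sigma : set 'rV[R]_d.+1) :
  chamber t sigma -> exists e : 'I_n -> R,
    forall xi, sigma° xi -> forall i, 0 < e i * q xi (t i).
Proof.
move=> [xi0 xi0P ->]; exists (fun i => q xi0 (t i)) => xi + i.
set e := q xi0 (t i).
have sub : closure (connected_component (hyperplane_complement t) xi0) `<=`
    [set x | 0 <= e * q x (t i)].
  pose f (x : 'rV[R]_d.+1) := e * q x (t i).
  have fc : continuous f.
    move=> x; apply: (@continuous_comp _ _ _ (fun x => q x (t i)) ( *%R e)).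
      exact: q_continuous.
    exact: mulrl_continuous.
  have cl : closed (f @^-1` [set y | 0 <= y]).
    exact: ((continuous_closedP f).1 fc _ (@closed_ge _ _)).
  rewrite closureEbigcap => x /(_ _ (conj cl _)); apply=> z Uz /=.
  rewrite /f /e; apply: ltW.
  apply: (q_gt0_connected (@component_connected _ (hyperplane_complement t) xi0)) => //.
    by move=> y /connected_component_sub; apply.
  exact: connected_component_refl.
move=> /nbhs_ballP[r /= r0 rU].
have e0 : e != 0 by exact: xi0P.
(* [u] holds the coefficients of the constant polynomial [e], so subtracting [a *: u] lowers
   [e * q xi (t i)] by [a * e ^+ 2]; with the [a] below the displacement has norm [r / 2]. *)
pose u : 'rV[R]_d.+1 := e *: delta_mx 0 0.
have u0 : 0 < `|u|.
  rewrite normr_gt0 scaler_eq0 (negbTE e0) /=; apply/eqP => /matrixP/(_ 0 0).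
  by rewrite !mxE !eqxx => /eqP; rewrite oner_eq0.
pose a := r / 2 / `|u|.
have a0 : 0 < a by rewrite !divr_gt0.
have : closure (connected_component (hyperplane_complement t) xi0) (xi - a *: u).
  apply: rU; rewrite -ball_normE /= opprB addrC subrK normrZ gtr0_norm //.
  by rewrite /a divfK ?gt_eqF // ltr_pdivrMr // ltr_pMr // ltr1n.
move=> /sub /=; rewrite [q _ _](_ : _ = q xi (t i) - a * e).
  rewrite mulrBr subr_ge0; apply: lt_le_trans.
  by rewrite mulrCA mulr_gt0 // -expr2 exprn_even_gt0.
rewrite /q (bigD1 ord0) //= [in RHS](bigD1 ord0) //= !mxE !eqxx /= expr0 !mulr1.
rewrite addrAC; congr (_ + _ - _); apply: eq_bigr => j j0.
by rewrite !mxE (negbTE j0) !mulr0 subr0.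
Qed.

(** * Dividers as sign changes *)

Lemma ordS_val n (i : 'I_n.+1) : ordS i = (if i == n :> nat then 0%N else i.+1) :> nat.
Proof.
rewrite /=; have [->|ni] := eqVneq (i : nat) n; first by rewrite modnn.
by rewrite modn_small // ltnS ltn_neqAle ni -ltnS ltn_ord.
Qed.

Section SignedDecomposition.
Variables (R : realType) (d n : nat) (t : 'I_n.+1 -> R) (xi : 'rV[R]_d.+1).
Hypothesis xi_neq0 : forall i, q xi (t i) != 0.

Definition neg_at (i : 'I_n.+1) : bool := q xi (t i) < 0.

Lemma sg_neg_at i j :
  (Num.sg (q xi (t i)) == Num.sg (q xi (t j))) = (neg_at i == neg_at j).
Proof.
rewrite /neg_at; move: (xi_neq0 i) (xi_neq0 j).
have sg1 : (1 == -1 :> R) = false.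
  by apply/negbTE; rewrite gt_eqF // (lt_trans (ltrN10 _) ltr01).
case: (sgrP (q xi (t i))) => // _ _; case: (sgrP (q xi (t j))) => // _ _;
  by rewrite ?eqxx // 1?eq_sym.
Qed.

(* The parity term accounts for the additional divider, as the number of sign
   changes has the parity of [neg_at ord0 (+) neg_at ord_max]. *)
Definition divided_after (i : 'I_n.+1) : bool :=
  neg_at i (+) neg_at (ordS i) (+) ((i == ord_max) && odd d).

Variables (k : nat) (I : 'I_k.+1 -> {set 'I_n.+1}).
Hypothesis decI : signed_decomposition t xi I.

Let block_exists i : exists j, i \in I j.
Proof. by case: decI => /(_ i). Qed.

Let J i : 'I_k.+1 := xchoose (block_exists i).

Let IJ i : i \in I (J i).
Proof. exact: (xchooseP (block_exists i)). Qed.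

Let block_lt (i j : 'I_n.+1) : (J i < J j)%N -> (i < j)%N.
Proof. by case: decI => _ _ lt /lt; apply. Qed.

Let block_le (i j : 'I_n.+1) : (i <= j)%N -> (J i <= J j)%N.
Proof. by move=> ij; rewrite leqNgt; apply: contraL ij => /block_lt; rewrite -ltnNge. Qed.

Let block_mem i j : (i \in I j) = (J i == j).
Proof.
apply/idP/eqP => [ij|<- //]; have [_ _ lt] := decI.
by apply/val_inj; case: (ltngtP (J i) j) => // /lt H;
   [have := H _ _ (IJ i) ij | have := H _ _ ij (IJ i)]; rewrite ltnn.
Qed.

Let block_onto j : exists i, J i = j.
Proof.
have [_ /(_ j) /maxsetP[/and3P[/finset.set0Pn[i ij] _ _] _] _] := decI.
by exists i; apply/eqP; rewrite -block_mem.
Qed.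

Let block_neg_at i j : J i = J j -> neg_at i = neg_at j.
Proof.
move=> ij; have [_ /(_ (J i)) /maxsetP[/and3P[_ _ sgI] _] _] := decI.
apply/eqP; rewrite -sg_neg_at.
move/forall_inP: sgI => /(_ i (IJ i)) /forall_inP; apply.
by rewrite block_mem ij.
Qed.

(** A skipped block would contain an index strictly between [i] and [i.+1]; an unchanged sign would
    let [j] join the run of [i], against maximality. *)
Let block_step (i j : 'I_n.+1) : j = i.+1 :> nat -> J j != J i ->
  J j = (J i).+1 :> nat /\ neg_at j = ~~ neg_at i.
Proof.
move=> ji nJ; have lJ : (J i < J j)%N.
  by rewrite ltn_neqAle (inj_eq val_inj) eq_sym nJ block_le // ji.
split.
  apply/eqP; rewrite eqn_leq lJ andbT leqNgt; apply/negP => lJ2.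
  have lk : ((J i).+1 < k.+1)%N := ltn_trans lJ2 (ltn_ord _).
  have [m mE] := block_onto (Ordinal lk).
  have im : (i < m)%N by apply: block_lt; rewrite mE.
  have mj : (m < j)%N by apply: block_lt; rewrite mE.
  by rewrite ji ltnS leqNgt im in mj.
have [_ /(_ (J i)) /maxsetP[/and3P[_ convI sgI] maxI] _] := decI.
case: (eqVneq (neg_at j) (neg_at i)) => [same|]; last by case: neg_at (neg_at i) => -[].
suff /maxI : sign_run t xi (j |: I (J i))%SET.
  move=> /(_ (finset.subsetUr _ _))/setP/(_ j); rewrite finset.in_setU1 eqxx block_mem.
  by rewrite (negbTE nJ).
have le_i a : a \in I (J i) -> (a <= i)%N.
  rewrite block_mem => /eqP Ja; rewrite leqNgt -ltnS -ji; apply/negP => /block_le.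
  by rewrite Ja leqNgt lJ.
apply/and3P; split.
- by apply/finset.set0Pn; exists j; rewrite finset.setU11.
- apply/forall_inP => a aI; apply/forall_inP => c cI; apply/forallP => b.
  apply/implyP => /andP[ab bc]; rewrite finset.in_setU1.
  have [//|nbj /=] := eqVneq b j.
  have bi : (b <= i)%N.
    rewrite -ltnS -ji ltn_neqAle (inj_eq val_inj) nbj (leq_trans bc) //.
    by move: cI; rewrite finset.in_setU1 => /predU1P[->//|/le_i ci]; rewrite ji leqW.
  have aJ : a \in I (J i).
    move: aI; rewrite finset.in_setU1 => /predU1P[e|//].
    by move: (leq_trans ab bi); rewrite e ji ltnn.
  move/forall_inP: convI => /(_ _ aJ)/forall_inP/(_ _ (IJ i))/forallP/(_ b)/implyP.
  by apply; rewrite ab.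
- have sgi a : a \in (j |: I (J i))%SET -> neg_at a = neg_at i.
    by rewrite finset.in_setU1 block_mem => /predU1P[->//|/eqP/block_neg_at].
  by apply/forall_inP => a /sgi ea; apply/forall_inP => b /sgi eb;
    rewrite sg_neg_at ea eb.
Qed.

Let block_first : J ord0 = ord0.
Proof.
have [i i0] := block_onto ord0; apply/val_inj/eqP.
by rewrite -leqn0 -[X in (_ <= X)%N]/(val (@ord0 k)) -i0 block_le.
Qed.

Let block_last : J ord_max = ord_max.
Proof.
have [i iM] := block_onto ord_max; apply/val_inj/eqP; rewrite eqn_leq -ltnS ltn_ord /=.
by rewrite -[X in (X <= _)%N]/(val (@ord_max k)) -iM block_le // -ltnS.
Qed.

(** Each passage to the next block flips the sign. At [ord_max], in block [k], this turns the
    comparison of the first and last signs into the parity of [k]. *)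
Let block_parity i : neg_at i = neg_at ord0 (+) odd (J i).
Proof.
case: i => m; elim: m => [|m IHm] ltm.
  by rewrite (_ : Ordinal ltm = ord0) ?block_first ?addbF //; apply: val_inj.
have ltm' := ltnW ltm; have := @block_step (Ordinal ltm') (Ordinal ltm) erefl.
have [e _|_ /(_ isT)[-> ->]] := eqVneq (J (Ordinal ltm)) (J (Ordinal ltm')).
  by rewrite (block_neg_at e) e.
by rewrite IHm /= addbN.
Qed.

Let is_lastP j a : is_last (I j) a -> J a = j /\ forall b, J b = j -> (b <= a)%N.
Proof.
move=> /andP[]; rewrite block_mem => /eqP aj /forall_inP H; split=> // b bj.
by apply: H; rewrite block_mem bj.
Qed.

Let is_firstP j a : is_first (I j) a -> J a = j /\ forall b, J b = j -> (a <= b)%N.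
Proof.
move=> /andP[]; rewrite block_mem => /eqP aj /forall_inP H; split=> // b bj.
by apply: H; rewrite block_mem bj.
Qed.

Let ordS_max : ordS ord_max = ord0 :> 'I_n.+1.
Proof. by apply: ord_inj; rewrite ordS_val eqxx. Qed.

(** Before [ord_max], passages between blocks are exactly the sign changes; at [ord_max],
    [divided_after] equals [odd k (+) odd d], the condition for the additional divider. *)
Lemma dividersP (X : finType) (tau : 'I_n.+1 -> X) (B : {set X}) :
  reflect (exists2 i, divided_after i & B = [set tau i; tau (ordS i)]%SET)
    (B \in dividers d tau I).
Proof.
rewrite inE; apply: (iffP existsP) => [[a /existsP[b /andP[/eqP -> /orP[|]]]]|[i]].
- move=> /existsP[j /existsP[j' /and3P[/eqP jj' /is_lastP[aj la] /is_firstP[bj fb]]]].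
  have lJ : (J a < J b)%N by rewrite aj bj jj'.
  have ab := block_lt lJ.
  (* If [b] were larger, [a.+1] would lie in the block of [a] or of [b], but [a] is last and [b] is
     first. *)
  have bS : b = a.+1 :> nat.
    apply/eqP; rewrite eqn_leq ab andbT leqNgt; apply/negP => lt.
    have ltn1 : (a.+1 < n.+1)%N := ltn_trans lt (ltn_ord b).
    pose m := Ordinal ltn1.
    have am : (J a <= J m)%N by apply: block_le; rewrite /= leqnSn.
    have mb : (J m <= J b)%N by apply: block_le; rewrite /= ltnW.
    move: am mb; rewrite leq_eqVlt aj bj => /orP[/eqP/val_inj mj _|].
      by have := la m (esym mj); rewrite /= ltnn.
    move=> jm mj'; have /fb : J m = j'.
      by apply/ord_inj/eqP; rewrite eqn_leq mj' jj' jm.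
    by rewrite leqNgt lt.
  have aM : (a == ord_max) = false.
    by apply/negbTE; rewrite -(inj_eq val_inj) /= ltn_eqF // -ltnS -bS.
  have bE : b = ordS a.
    by apply: ord_inj; rewrite ordS_val bS; move: aM; rewrite -(inj_eq val_inj) /= => ->.
  have dab : divided_after a.
    have nJ : J b != J a by apply: contraTneq lJ => ->; rewrite ltnn.
    by rewrite /divided_after aM -bE (block_step bS nJ).2 addbN addbb.
  by exists a; rewrite -?bE.
- move=> /and3P[odk /is_lastP[aM la] /is_firstP[b0 fb]].
  have aE : a = ord_max.
    by apply/val_inj/eqP; rewrite eqn_leq -ltnS ltn_ord; apply/la/block_last.
  have bE : b = ord0.
    by apply/val_inj/eqP; rewrite eqn_leq andbT; apply/fb/block_first.
  exists a; last by rewrite aE ordS_max bE.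
  rewrite /divided_after aE eqxx ordS_max (block_parity ord_max) block_last.
  by move: odk; rewrite /=; case: neg_at (odd d) (odd k) => -[] [].
- move=> di ->; exists i; apply/existsP; exists (ordS i); rewrite eqxx /=; apply/orP.
  have [iM|niM] := eqVneq i ord_max.
    right; apply/and3P; split.
    + move: di; rewrite /divided_after iM eqxx ordS_max (block_parity ord_max) block_last.
      by rewrite /=; case: neg_at (odd d) (odd k) => -[] [].
    + apply/andP; split; first by rewrite block_mem iM block_last.
      by apply/forall_inP => b _; rewrite iM -ltnS.
    + apply/andP; split; first by rewrite block_mem iM ordS_max block_first.
      by apply/forall_inP => b _; rewrite iM ordS_max.
  have Si : ordS i = i.+1 :> nat.
    by rewrite ordS_val; move: niM; rewrite -(inj_eq (@ord_inj _)) /= => /negbTE ->.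
  have nJ : J (ordS i) != J i.
    apply: contraTneq di => /block_neg_at e.
    by rewrite /divided_after e addbb (negbTE niM).
  have [JS _] := block_step Si nJ.
  left; apply/existsP; exists (J i); apply/existsP; exists (J (ordS i)).
  apply/and3P; split; first by rewrite JS.
    apply/andP; split; first exact: IJ.
    apply/forall_inP => b; rewrite block_mem => /eqP bi; rewrite leqNgt; apply/negP.
    by rewrite -Si => /block_le; rewrite JS bi ltnn.
  apply/andP; split; first exact: IJ.
  apply/forall_inP => b; rewrite block_mem => /eqP bi; rewrite Si; apply: block_lt.
  by rewrite bi JS.
Qed.

End SignedDecomposition.

(** * Gale evenness as a parity on the cycle *)

Section Parity.
Variables (R : realType) (d n : nat) (t : 'I_n.+1 -> R) (xi : 'rV[R]_d.+1).
Hypothesis t_lt : forall i j : 'I_n.+1, (i < j)%N -> t i < t j.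
Hypothesis xi_neq0 : forall i, q xi (t i) != 0.
Variable S : {set 'I_n.+1}.
Hypothesis cardS : #|S| = d.

(* For [i] outside [S], the parity of the number of negative factors of
   [q xi (t i) * \prod_(j in S) (t i - t j)]. *)
Definition sign_parity (i : 'I_n.+1) : bool :=
  odd #|[set j in S | (i <= j)%N]%SET| (+) neg_at t xi i.

Lemma sign_parityP i : i \notin S ->
  0 < (-1) ^+ sign_parity i * ((root_poly t S).[t i] * q xi (t i)).
Proof.
move=> iS; rewrite /sign_parity signr_addb mulrACA; apply: mulr_gt0; last first.
  rewrite /neg_at; have [q0|q0|q0] := ltgtP (q xi (t i)) 0.
  - by rewrite expr1 mulN1r oppr_gt0.
  - by rewrite expr0 mul1r.
  - by move: (xi_neq0 i); rewrite q0 eqxx.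
(* As a sum of indicators the exponent distributes over the factors of [root_poly]; as [i] is not in
   [S], [i <= j] marks exactly the negative ones. *)
have -> : #|[set j in S | (i <= j)%N]%SET| = (\sum_(j in S) (i <= j))%N.
  rewrite -sum1_card big_mkcond [RHS]big_mkcond; apply: eq_bigr => j _.
  by rewrite !inE; case: (j \in S); case: (i <= j)%N.
rewrite signr_odd expr_sum horner_root_poly -big_split /=; apply: prodr_gt0 => j jS.
have nij : i != j by apply: contraNneq iS => ->.
have [ij|ji] := ltnP i j.
  by rewrite ltnW // expr1 mulN1r oppr_gt0 subr_lt0 t_lt.
have lt : (j < i)%N by rewrite ltn_neqAle (inj_eq (@ord_inj _)) eq_sym nij.
by rewrite leqNgt lt expr0 mul1r subr_gt0 t_lt.
Qed.

Lemma same_signP :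
  (exists e : R, forall i, i \notin S -> 0 < e * (root_poly t S).[t i] * q xi (t i))
  <-> exists c, forall i, i \notin S -> sign_parity i = c.
Proof.
split=> [[e He]|[c Hc]]; last first.
  by exists ((-1) ^+ c) => i iS; rewrite -(Hc i iS) -mulrA sign_parityP.
exists (e < 0) => i iS; move: (He i iS) (sign_parityP iS); rewrite -mulrA.
set y := _ * q _ _; case: sign_parity; rewrite ?expr1 ?expr0 ?mulN1r ?mul1r.
  by rewrite oppr_gt0 => ey y0; move: ey; rewrite nmulr_lgt0.
by move=> ey y0; move: ey; rewrite pmulr_lgt0 // => /ltW; rewrite leNgt => /negbTE.
Qed.

(** Before [ord_max] the count can lose only [i]. After [ord_max] it restarts with all of [S], whose
    parity [odd d] is the extra term of [divided_after]; so one rule holds all around the circle. *)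
Lemma sign_parity_ordS i :
  sign_parity (ordS i) = sign_parity i (+) (i \in S) (+) divided_after t xi i.
Proof.
rewrite /sign_parity /divided_after; have [->|niM] := eqVneq i ord_max.
  have -> : [set j in S | (ordS (@ord_max n) <= j)%N]%SET = S.
    by apply/setP => j; rewrite inE ordS_val eqxx andbT.
  have -> : #|[set j in S | (@ord_max n <= j)%N]%SET| = (ord_max \in S).
    rewrite (cardsD1 ord_max) !inE leqnn andbT [X in (_ + X)%N](_ : _ = 0%N) ?addn0 //.
    apply: eq_card0 => j.
    rewrite !inE -(inj_eq (@ord_inj _)) eqn_leq -ltnS ltn_ord /= andbA [_ && (_ \in _)]andbC.
    by rewrite -andbA andNb andbF.
  rewrite cardS oddb; move: (neg_at t xi (ordS ord_max)) (neg_at t xi ord_max).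
  by case: (odd d) (ord_max \in S) => -[] [] [].
have Si : ordS i = i.+1 :> nat.
  by rewrite ordS_val; move: niM; rewrite -(inj_eq (@ord_inj _)) /= => /negbTE ->.
have -> : #|[set j in S | (i <= j)%N]%SET| =
    ((i \in S) + #|[set j in S | (ordS i <= j)%N]%SET|)%N.
  rewrite (cardsD1 i) !inE leqnn andbT; congr (_ + #|pred_of_set _|)%N.
  apply/setP => j; rewrite !inE Si ltn_neqAle (inj_eq (@ord_inj _)) eq_sym.
  by rewrite andbCA.
rewrite oddD oddb; move: (odd #|_|) (neg_at t xi (ordS i)) (neg_at t xi i).
by case: (i \in S) => -[] [] [].
Qed.

(** [sign_parity] and [h] obey the same recursion, so they differ by a constant, which is the value
    of [sign_parity] wherever [h] vanishes. *)
Lemma sign_parity_constP :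
  (exists c, forall i, i \notin S -> sign_parity i = c) <->
  exists h : 'I_n.+1 -> bool, (forall i, i \notin S -> h i = false) /\
    forall i, h (ordS i) = h i (+) (i \in S) (+) divided_after t xi i.
Proof.
split=> [[c Hc]|[h [h0 hS]]].
  exists (fun i => sign_parity i (+) c); split=> [i /Hc ->|i]; first exact: addbb.
  rewrite sign_parity_ordS; move: (sign_parity i) (divided_after t xi i).
  by case: (i \in S) c {Hc} => -[] [] [].
have inv i : sign_parity i (+) h i = sign_parity ord0 (+) h ord0.
  case: i => m; elim: m => [|m IHm] ltm.
    by rewrite (_ : Ordinal ltm = ord0) //; apply: val_inj.
  have ltm' := ltnW ltm; rewrite -(IHm ltm').
  have -> : Ordinal ltm = ordS (Ordinal ltm').
    by apply: ord_inj; rewrite ordS_val /= ltn_eqF.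
  rewrite sign_parity_ordS hS.
  set j := Ordinal ltm'; move: (sign_parity j) (divided_after t xi j) (h j).
  by case: (j \in S) => -[] [] [].
by exists (sign_parity ord0 (+) h ord0) => i iS; rewrite -(inv i) h0 // addbF.
Qed.

End Parity.

(** * From the cyclic order to a successor map, and the theorem *)

Lemma follows_unique (X : finType) (C : X -> X -> X -> Prop) a b b' :
  cyclic_order C -> b != a -> b' != a -> follows C a b -> follows C a b' -> b = b'.
Proof.
move=> [rot asym _ _] ba b'a fb fb'; apply/eqP/negPn/negP => bb'.
(* Each of two distinct successors of [a] would come before the other on the way to [a], against
   asymmetry. *)
have := fb b'; rewrite eq_sym in bb'; move=> /(_ b'a bb') bb'a.
rewrite eq_sym in bb'; have /asym[] := fb' b ba bb'.
exact/rot/rot.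
Qed.

Theorem theorem3p9 (R : realType) (d n : nat) (hd : (1 <= d)%N)
    (hn : (d.+1 <= n)%N) (t : 'I_n -> R)
    (ht : forall i j : 'I_n, (i < j)%N -> t i < t j)
    (sigma : set 'rV[R]_d.+1) (hsigma : chamber t sigma)
    (X : finType) (tau : 'I_n -> X) (C : X -> X -> X -> Prop)
    (D : {set {set X}})
    (hCD : induced_circular_composition t tau sigma C D)
    (xi : 'rV[R]_d.+1) (hxi : sigma° xi)
    (S : {set 'I_n}) (hS : #|S| = d) :
  corresponds_to_facet t xi S <->
  circular_facet_condition C d D (tau @: S)%SET.
Proof.
case: n => [//|n] in hn t ht hsigma tau hCD S hS *.
have t_inj : injective t.
  move=> i j tij; apply/ord_inj/eqP; case: ltngtP => // /ht; by rewrite tij ltxx.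
have [e esgn] := chamber_sign hsigma.
have neq0 x : sigma° x -> forall i, q x (t i) != 0.
  by move=> /esgn sgn i; apply: contraTneq (sgn i) => ->; rewrite mulr0 ltxx.
have [[rho tauK rhoK] cyc fol folM [xi' [k [I [hxi' decI DE]]]]] := hCD.
(* The dividers come from some [xi'] that may differ from [xi]; both have the signs of the
   chamber. *)
have negE i : neg_at t xi i = neg_at t xi' i.
  have := esgn _ hxi i; have := esgn _ hxi' i; rewrite /neg_at.
  have [e0|e0|->] := ltgtP (e i) 0; last by rewrite mul0r ltxx.
    by rewrite !nmulr_rgt0 // => -> ->.
  by rewrite !pmulr_rgt0 // => /ltW + /ltW; rewrite !ltNge => -> ->.
have divE i : divided_after t xi i = divided_after t xi' i.
  by rewrite /divided_after !negE.
pose nxt x := tau (ordS (rho x)); pose prv x := tau (ord_pred (rho x)).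
have nxtK : cancel nxt prv by move=> x; rewrite /nxt /prv tauK ordSK rhoK.
have prvK : cancel prv nxt by move=> x; rewrite /nxt /prv tauK ord_predK rhoK.
have ordS_neq i : ordS i != i :> 'I_n.+1.
  rewrite -(inj_eq (@ord_inj _)) ordS_val; case: (eqVneq (i : nat) n) => [->|_].
    by rewrite eq_sym -lt0n (leq_trans hd).
  by rewrite gtn_eqF.
have nxt_neq x : nxt x != x by rewrite -[X in _ != X]rhoK (can_eq tauK) ordS_neq.
have fol_nxt x : follows C x (nxt x).
  rewrite -{1}(rhoK x) /nxt; set i := rho x.
  have [iM|niM] := eqVneq (i : nat) n.
    by apply: folM => //; rewrite ordS_val iM eqxx.
  by apply: fol; rewrite ordS_val (negbTE niM).
have consE B : consecutive_pair C B <-> exists x, B = edge nxt x.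
  split=> [[a [b [ab -> [f|f]]]]|[x ->]].
  - exists a; congr [set a; _]%SET.
    by apply: (follows_unique cyc _ _ f (fol_nxt a)); rewrite ?nxt_neq // eq_sym.
  - exists b; rewrite finset.setUC; congr [set b; _]%SET.
    by apply: (follows_unique cyc _ _ f (fol_nxt b)); rewrite ?nxt_neq.
  - by exists x, (nxt x); split; [rewrite eq_sym|by []|left].
(* There are now [n.+1] points, so [n = 1] means a cycle of two. *)
have two_cycle x : nxt (nxt x) = x -> n = 1%N.
  rewrite /nxt tauK => xE; have {xE} : ordS (ordS (rho x)) = rho x.
    by rewrite -[in RHS]xE tauK.
  move=> /(congr1 (@nat_of_ord _)); rewrite !ordS_val; set i := rho x.
  have := ltn_ord i; rewrite ltnS.
  have := leq_trans hd hn.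
  by case: (eqVneq (i : nat) n) => [->|ni]; case: ifP => /eqP; lia.
have divD : D = (edge nxt @: (tau @: [set i | divided_after t xi i]))%SET.
  apply/setP => B; rewrite DE; apply/(dividersP (neq0 _ hxi') decI)/imsetP.
    move=> [i di ->]; exists (tau i); last by rewrite /edge /nxt tauK.
    by rewrite imset_f // inE divE.
  move=> [_ /imsetP[i + ->] ->]; rewrite inE divE => di.
  by exists i => //; rewrite /edge /nxt tauK.
have E_in x : (x \in (tau @: [set i | divided_after t xi i])%SET) = divided_after t xi (rho x).
  by rewrite -{1}(rhoK x) (mem_imset _ _ (can_inj tauK)) inE.
have S_in x : (x \in (tau @: S)%SET) = (rho x \in S).
  by rewrite -{1}(rhoK x) (mem_imset _ _ (can_inj tauK)).
have d1 : n = 1%N -> d = 1%N.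
  by move=> n1; apply/eqP; rewrite eqn_leq hd andbT -ltnS -n1.
(* With two points [d] is 1; the values of [divided_after] at both differ by [odd d], so only one of
   the two coinciding edges counts as divided. *)
have edge_inj : {in (tau @: [set i | divided_after t xi i])%SET &, injective (edge nxt)}.
  move=> x y; rewrite !E_in => dx dy /edge_eq[//|[yE xE]].
  have n1 : n = 1%N by apply: (two_cycle x); rewrite -yE.
  have xS : rho x = ordS (rho y) by rewrite -xE /nxt tauK.
  have yS : rho y = ordS (rho x) by rewrite yE /nxt tauK.
  have max_yx : (rho y == ord_max) = ~~ (rho x == ord_max).
    rewrite yS -!(inj_eq (@ord_inj _)) ordS_val /=; have := ltn_ord (rho x).
    by case: (eqVneq (rho x : nat) n); lia.
  move: dx dy; rewrite /divided_after -xS -yS max_yx.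
  have -> : odd d = true by rewrite d1.
  by case: neg_at (neg_at _ _ _) (rho x == ord_max) => -[] [].
have cardS : #|(tau @: S)%SET| = d by rewrite card_imset //; exact: can_inj tauK.
have two_cycleS x : nxt (nxt x) = x -> x \in (tau @: S)%SET -> nxt x \notin (tau @: S)%SET.
  move=> /two_cycle/d1 d_1 xS; apply/negP => nS.
  have : (#|edge nxt x| <= #|(tau @: S)%SET|)%N.
    by apply/subset_leq_card/fintype.subsetP => y; rewrite in_edge => /orP[] /eqP ->.
  by rewrite card_edge // cardS d_1.
have dn : (0 < d < n.+1)%N by rewrite hd.
apply: (iff_trans (corresponds_to_facetP t_inj (neq0 _ hxi) dn hS)).
apply: (iff_trans (same_signP ht (neq0 _ hxi) S)).
apply: (iff_trans (sign_parity_constP t xi hS)).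
rewrite divD; split=> [[h [h0 hE]]|].
  apply: (parity_circular_facet prvK nxtK nxt_neq consE edge_inj cardS (tau ord0) (h := h \o rho)).
    by move=> x; rewrite S_in => /h0.
  by move=> x; rewrite /= {1}/nxt tauK hE S_in E_in.
move=> /(circular_facet_parity prvK nxtK nxt_neq consE edge_inj two_cycleS)[h [h0 hE]].
exists (h \o tau); split=> [i iS|i /=].
  by apply: h0; rewrite S_in tauK.
by have := hE (tau i); rewrite {1}/nxt S_in E_in tauK.
Qed.
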